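(* If $m,n\geq 1$ are integers, then $\gamma_{3,3}(H_{m,n})\leq mn+m+n$.
   Context: The infinite truncated square tiling graph $H_{\infty,\infty}$ has vertex set $\{(a,(x,y)) : a\in\mathbb{Z}_4,\ (x,y)\in\mathbb{Z}^2\}$. Its edges are: $(a,(x,y))\sim(a+1,(x,y))$ with $a+1$ taken modulo 4 (so each $(x,y)$ carries a 4-cycle whose vertices $0,1,2,3$ are its top, right, bottom, left vertices); $(1,(x,y))\sim(3,(x+1,y))$; and $(0,(x,y))\sim(2,(x,y+1))$. For $(x,y)\in\mathbb{Z}^2$ the octagon $O_{x,y}$ is the 8-cycle through $(0,(x,y)),(1,(x,y)),(3,(x+1,y)),(0,(x+1,y)),(2,(x+1,y+1)),(3,(x+1,y+1)),(1,(x,y+1)),(2,(x,y+1))$, in this cyclic order. For positive integers $m,n$, $H_{m,n}$ is the finite subgraph consisting of $m$ rows of $n$ octagons each: the union of the octagons $O_{x,y}$ with $0\le x\le n-1$, $0\le y\le m-1$. For a graph $G$ and integers $1\le r\le t$, a set $T\subseteq V(G)$ is a $(t,r)$ broadcast (dominating set) of $G$ if every $u\in V(G)$ satisfies $\sum_{v\in T,\ d(u,v)<t}(t-d(u,v))\ge r$, where $d$ is the graph distance in $G$. For finite $G$, the $(t,r)$ broadcast domination number $\gamma_{t,r}(G)$ is the smallest cardinality of a $(t,r)$ broadcast of $G$. *)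

(* Defs.v *)
From HB Require Import structures.
From mathcomp Require Import all_boot all_order all_algebra.

Set Implicit Arguments.
Unset Strict Implicit.
Unset Printing Implicit Defensive.

Import GRing.Theory.

Section Broadcast.

Variables (T : finType) (e : rel T).

Definition walk (k : nat) (u v : T) : bool :=
  [exists p : k.-tuple T, path e u p && (last u p == v)].

(* [None] stands for infinite distance.  Searching below #|T| loses nothing,
   since a shortest walk repeats no vertex; see [gdistP]. *)
Definition gdist (u v : T) : option nat :=
  ohead [seq k <- iota 0 #|T| | walk k u v].

(* The subtraction is truncated, so the value is 0 as soon as d(u, v) >= t. *)
Definition signal (t : nat) (u v : T) : nat :=
  if gdist u v is Some d then t - d else 0.

Definition broadcast (t r : nat) (S : {set T}) : bool :=
  [forall u, r <= \sum_(v in S) signal t u v].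

(* The base point [set: T] is a (t, r) broadcast whenever r <= t, so this is a
   genuine minimum in that range; see [gammaP]. *)
Definition gamma (t r : nat) : nat :=
  #|[arg min_(S < [set: T] | broadcast t r S) #|S|]|.

Lemma walkP k u v :
  reflect (exists p, [/\ path e u p, last u p = v & size p = k]) (walk k u v).
Proof.
apply: (iffP existsP) => [[p /andP[pp /eqP lp]]|[p [pp lp sp]]].
  by exists p; rewrite size_tuple.
by exists (tcast sp (in_tuple p)); rewrite val_tcast /= pp lp eqxx.
Qed.

Lemma walk_short k u v : walk k u v -> exists2 j, j < #|T| & (j <= k) && walk j u v.
Proof.
case/walkP=> p [pp lp <-]; case/shortenP: pp lp => q qp uq sq lq.
have sqp : size q <= size p.
  by apply: uniq_leq_size => //; case/andP: uq.
exists (size q); first by rewrite -[_ < _]/(size (u :: q) <= _) -(card_uniqP uq) max_card.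
by rewrite sqp; apply/walkP; exists q.
Qed.

Lemma gdistP u v k :
  gdist u v = Some k <-> walk k u v /\ (forall j, walk j u v -> k <= j).
Proof.
rewrite /gdist; set s := filter _ _.
have ms j : (j \in s) = (j < #|T|) && walk j u v.
  by rewrite mem_filter mem_iota andbC.
have ss : sorted leq s.
  by apply: sorted_filter; [exact: leq_trans | exact: iota_sorted].
case: s ms ss => [|i s] ms ss /=; split=> //.
- by case=> /walk_short[j jT /andP[_ wj]]; have := ms j; rewrite jT wj.
- case=> <-; have := ms i; rewrite mem_head => /esym/andP[_ wi]; split=> // j.
  case/walk_short=> l lT /andP[lj wl]; apply: leq_trans lj.
  have := ms l; rewrite lT wl inE => /predU1P[->//|ls].
  by move: (order_path_min leq_trans ss) => /allP/(_ _ ls).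
- case=> wk mk; congr Some; have := ms i; rewrite mem_head => /esym/andP[iT wi].
  apply/eqP; rewrite eqn_leq mk // andbT.
  have := ms k; rewrite wk (leq_ltn_trans (mk _ wi) iT) inE => /predU1P[->//|ks].
  by move: (order_path_min leq_trans ss) => /allP/(_ _ ks).
Qed.

Lemma gdist0 u : gdist u u = Some 0.
Proof. by apply/gdistP; split=> //; apply/walkP; exists [::]. Qed.

Lemma broadcastT t r : r <= t -> broadcast t r [set: T].
Proof.
move=> rt; apply/forallP=> u; apply: leq_trans rt _.
by rewrite (bigD1 u) ?inE //= {1}/signal gdist0 subn0 leq_addr.
Qed.

Lemma gammaP t r : r <= t ->
  (exists2 S, broadcast t r S & #|S| = gamma t r) /\
  (forall S, broadcast t r S -> gamma t r <= #|S|).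
Proof.
move=> rt; rewrite /gamma; case: arg_minnP => [|S bS mS]; first exact: broadcastT.
by split=> //; exists S.
Qed.

End Broadcast.

(* (a, (x, y)) with a = 0, 1, 2, 3 the top, right, bottom, left vertex of the
   square at (x, y). *)
Definition vertex : Type := ('Z_4 * (int * int))%type.
HB.instance Definition _ := Choice.on vertex.

Local Open Scope ring_scope.

Definition Hinf_arc (u v : vertex) : bool :=
  let: (a, (x, y)) := u in
  [|| v == (a + 1, (x, y)),
      (a == 0) && (v == (2, (x, y + 1)))
    | (a == 1) && (v == (3, (x + 1, y)))].

Definition Hinf : rel vertex := fun u v => Hinf_arc u v || Hinf_arc v u.

Definition octagon (x y : int) : seq vertex :=
  [:: (0, (x, y)); (1, (x, y)); (3, (x + 1, y)); (0, (x + 1, y));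
      (2, (x + 1, y + 1)); (3, (x + 1, y + 1)); (1, (x, y + 1));
      (2, (x, y + 1))].

Lemma octagon_cycle x y : ucycle Hinf (octagon x y).
Proof.
have n1 z : (z == z + 1 :> int) = false by rewrite -[eqbLHS]addr0 (inj_eq (addrI z)).
have n2 z : (z + 1 == z :> int) = false by rewrite eq_sym n1.
by rewrite /ucycle /= /Hinf /Hinf_arc !inE !xpair_eqE !eqxx ?n1 ?n2.
Qed.

Definition cycle_edge (c : seq vertex) (u v : vertex) : bool :=
  (u \in c) && (v == next c u) || (v \in c) && (u == next c v).

Definition octagons (m n : nat) : seq (seq vertex) :=
  [seq octagon x%:Z y%:Z | y <- iota 0 m, x <- iota 0 n].

(* The union of the octagons as a graph: [H_vertex m n] is the type of vertices
   lying on one of them, and edges are the edges of the octagon cycles. *)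
Definition H_vertex (m n : nat) : finType := seq_sub (flatten (octagons m n)).

Definition H (m n : nat) : rel (H_vertex m n) :=
  fun u v => has (fun c => cycle_edge c (ssval u) (ssval v)) (octagons m n).

Lemma H_sub_Hinf m n (u v : H_vertex m n) : H u v -> Hinf (ssval u) (ssval v).
Proof.
have Hsym a b : Hinf a b = Hinf b a by rewrite /Hinf orbC.
case/hasP=> c /allpairsP[[y x] [_ _ ->]] /=.
have /andP[cyc _] := octagon_cycle x%:Z y%:Z.
by case/orP=> /andP[uc /eqP->]; [|rewrite Hsym]; apply: next_cycle.
Qed.

(* Main.v *)
Require Import Defs.
From mathcomp Require Import all_boot all_order all_algebra.

(** Take the top vertex [(0, (x, y))] of every square that has one, that is
    [0 <= x <= n] and [0 <= y < m], together with the right vertex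
    [(1, (x, m))] of every square of the last row but its rightmost one.  These
    are [m * (n + 1) + n = m * n + m + n] vertices, and each vertex [u] receives
    signal at least 3 from them: either [u] is one of them, or two distinct ones
    lie at distances at most 1 and at most 2 from [u], contributing [2 + 1]
    ([two_towers]).

    Below the last row, a left or right vertex is adjacent to its own top, and
    its horizontal neighbour is adjacent to another top; a bottom vertex is
    adjacent to the top of the square below and opposite to its own top.  On
    the last row the own top is missing.  There the top of the square below
    gives a bottom vertex 2 and a side vertex 1, and the remaining 1 or 2
    come from the chosen right vertices, which lie on the path running along
    the upper boundary.

    Every walk used stays in a single octagon [(x, y)], except those from a
    bottom vertex [(2, (_, y + 1))] to the top of its own square, which end in
    octagon [(x, y + 1)].  So it suffices to go round the eight vertices of one
    octagon ([octagon_covered]), distinguishing whether another octagon lies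
    above it. *)

(** * Signals from walks *)

Section Signals.

Context {T : finType} (e : rel T).

(** Exact distances are never computed: a walk bounds the distance from above,
    hence the signal from below. *)
Lemma signal_walk t k u p :
  path e u p -> size p <= k -> t - k <= signal e t u (last u p).
Proof.
move=> pp spk; have w : walk e (size p) u (last u p) by apply/walkP; exists p.
rewrite /signal; case gd: (gdist e u _) => [d|].
  have [_ /(_ _ w) dp] := (gdistP e u (last u p) d).1 gd.
  exact: leq_sub2l (leq_trans dp spk).
(* The distance is finite, since a shortest walk has fewer than [#|T|] edges. *)
have [j jT /andP[_ wj]] := walk_short w; move/eqP: gd; apply: contraLR => _.
rewrite /gdist; have: j \in [seq k <- iota 0 #|T| | walk e k u (last u p)].
  by rewrite mem_filter mem_iota wj.
by case: [seq _ <- _ | _].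
Qed.

Lemma self_tower t (S : {set T}) u :
  u \in S -> t <= \sum_(v in S) signal e t u v.
Proof.
move=> uS; rewrite (bigD1 u) //=; apply: leq_trans (leq_addr _ _).
by have := @signal_walk t 0 u [::] isT isT; rewrite subn0.
Qed.

Lemma two_towers t k1 k2 (S : {set T}) u p q :
    path e u p -> size p <= k1 -> last u p \in S ->
    path e u q -> size q <= k2 -> last u q \in S ->
    last u p != last u q ->
  (t - k1) + (t - k2) <= \sum_(v in S) signal e t u v.
Proof.
move=> pp sp Sp pq sq Sq pDq.
rewrite (bigD1 (last u p)) //= (bigD1 (last u q)) /=; last first.
  by rewrite Sq eq_sym.
by rewrite addnA (leq_trans _ (leq_addr _ _)) // leq_add // signal_walk.
Qed.

End Signals.

(** * Walks along octagons *)

Local Notation topv x y := (0%R, (Posz x, Posz y)).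
Local Notation rightv x y := (1%R, (Posz x, Posz y)).
Local Notation bottomv x y := (2%:R%R, (Posz x, Posz y)).
Local Notation leftv x y := (3%:R%R, (Posz x, Posz y)).

Lemma octagon_natE (x y : nat) :
  octagon (Posz x) (Posz y) =
    [:: topv x y; rightv x y; leftv x.+1 y; topv x.+1 y;
        bottomv x.+1 y.+1; leftv x.+1 y.+1; rightv x y.+1; bottomv x y.+1].
Proof. by rewrite /octagon -!PoszD !addn1. Qed.

Section Octagons.

Variables m n : nat.

(** The adjacency of [H m n] on bare vertices: membership in the graph comes for
    free along an edge ([lift_path]), so walks can be written without proofs. *)
Definition adj (a b : vertex) : bool :=
  has (fun c => cycle_edge c a b) (octagons m n).

Lemma adj_sym a b : adj a b = adj b a.
Proof. by apply: eq_has => c; rewrite /cycle_edge orbC. Qed.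

Lemma adj_vertex a b : adj a b -> b \in flatten (octagons m n).
Proof.
case/hasP=> c cO ab; apply/flattenP; exists c => //.
by case/orP: ab => /andP[ac /eqP E] //; rewrite E mem_next.
Qed.

Lemma lift_path (u : H_vertex m n) p :
  path adj (ssval u) p ->
  exists2 q, path (@H m n) u q & map (@ssval _ _) q = p.
Proof.
elim: p u => [|b p IHp] u /=; first by exists [::].
case/andP=> ub; have bH := adj_vertex _ _ ub.
case/(IHp (SeqSub bH)) => q uq <-.
by exists (SeqSub bH :: q); rewrite //= uq andbT.
Qed.

Lemma octagon_adj (x y : nat) :
  x < n -> y < m -> cycle adj (octagon (Posz x) (Posz y)).
Proof.
move=> xn ym; have /andP[_ U] := octagon_cycle (Posz x) (Posz y).
apply: sub_in_cycle (allss _) (cycle_next U) => a b ac _ /eqP Eb.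
apply/hasP; exists (octagon (Posz x) (Posz y)).
  by apply/allpairsP; exists (y, x); rewrite !mem_iota /= !add0n.
by rewrite /cycle_edge ac -Eb eqxx.
Qed.

(** * The broadcast *)

Definition towers : seq vertex :=
  [seq topv x y | y <- iota 0 m, x <- iota 0 n.+1]
    ++ [seq rightv x m | x <- iota 0 n].

Lemma size_towers : size towers = m * n + m + n.
Proof. by rewrite size_cat size_allpairs size_map !size_iota mulnS (addnC m). Qed.

Lemma top_tower (x y : nat) : x <= n -> y < m -> topv x y \in towers.
Proof.
move=> xn ym; rewrite mem_cat; apply/orP; left; apply/allpairsP.
by exists (y, x); rewrite !mem_iota /= !add0n.
Qed.

Lemma last_row_tower (x : nat) : x < n -> rightv x m \in towers.
Proof.
move=> xn; rewrite mem_cat; apply/orP; right; apply/mapP.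
by exists x; rewrite ?mem_iota.
Qed.

(** The sufficient condition of the proof idea.  The walks are only bounded in
    length: on the last row both towers can be at distance 1, where the
    bipartite graph has no walk of length 2 between the same ends. *)
Definition covered (a : vertex) : Prop :=
  a \in towers \/
  exists p q : seq vertex,
    [/\ path adj a p && (size p <= 1), path adj a q && (size q <= 2),
        last a p \in towers, last a q \in towers & last a p != last a q].

Lemma octagon_covered (x y : nat) :
  x < n -> y < m -> {in octagon (Posz x) (Posz y), forall a, covered a}.
Proof.
(* The two vertices on the upper side of an octagon are also on the lower side
   of the next one, and are treated there when it exists. *)
move=> xn; have lower (y' : nat) : y' < m ->
    covered (rightv x y') /\ covered (leftv x.+1 y').
  move=> ym; have := octagon_adj _ _ xn ym.
  rewrite octagon_natE /= => /and5P[e1 e2 e3 _ _].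
  have t0 := top_tower _ _ (ltnW xn) ym; have t1 := top_tower _ _ xn ym.
  split; right.
    exists [:: topv x y'], [:: leftv x.+1 y'; topv x.+1 y'].
    rewrite /= adj_sym e1 e2 e3; split=> //.
    by rewrite !xpair_eqE /= eqz_nat ltn_eqF.
  exists [:: topv x.+1 y'], [:: rightv x y'; topv x y'].
  rewrite /= e3 adj_sym e2 adj_sym e1; split=> //.
  by rewrite !xpair_eqE /= eqz_nat gtn_eqF.
move=> ym; have := octagon_adj _ _ xn ym.
rewrite octagon_natE [cycle _ _]/= => /and5P[e1 e2 e3 e4 /and5P[e5 e6 e7 e8 _]].
have t0 := top_tower _ _ (ltnW xn) ym; have t1 := top_tower _ _ xn ym.
have [c1 c3] := lower y ym.
suff [c2 c3' c1' c2'] : [/\ covered (bottomv x.+1 y.+1), covered (leftv x.+1 y.+1),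
                            covered (rightv x y.+1) & covered (bottomv x y.+1)].
  move=> a; rewrite !inE.
  by do 7![case/predU1P=> [->|]; first by [assumption | left]]; move/eqP=> ->.
case: (ltnP y.+1 m) => [ySm|mSy].
  have [d1 d3] := lower y.+1 ySm; have := octagon_adj _ _ xn ySm.
  rewrite octagon_natE [cycle _ _]/= => /and5P[f1 f2 f3 _ _].
  have s0 := top_tower _ _ (ltnW xn) ySm; have s1 := top_tower _ _ xn ySm.
  split=> //; right.
    exists [:: topv x.+1 y], [:: leftv x.+1 y.+1; topv x.+1 y.+1].
    rewrite /= adj_sym e4 e5 f3; split=> //.
    by rewrite !xpair_eqE /= !eqz_nat eqxx ltn_eqF.
  exists [:: topv x y], [:: rightv x y.+1; topv x y.+1].
  rewrite /= e8 adj_sym e7 adj_sym f1; split=> //.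
  by rewrite !xpair_eqE /= !eqz_nat eqxx ltn_eqF.
have Em : y.+1 = m by apply/eqP; rewrite eqn_leq ym.
have s1 : rightv x y.+1 \in towers by rewrite Em last_row_tower.
(* On the last row the missing tops are replaced by the tower [rightv x m]. *)
split; [right|right|by left|right].
- exists [:: topv x.+1 y], [:: leftv x.+1 y.+1; rightv x y.+1].
  by rewrite /= adj_sym e4 e5 e6.
- exists [:: rightv x y.+1], [:: bottomv x.+1 y.+1; topv x.+1 y].
  by rewrite /= e6 adj_sym e5 adj_sym e4.
- exists [:: topv x y], [:: rightv x y.+1].
  by rewrite /= e8 adj_sym e7.
Qed.

Definition tower_set : {set H_vertex m n} := [set u | ssval u \in towers].

Lemma card_tower_set : #|tower_set| <= m * n + m + n.
Proof.
rewrite -size_towers cardE -(size_map (@ssval _ _)); apply: uniq_leq_size.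
  by rewrite map_inj_uniq ?enum_uniq //; exact: val_inj.
by move=> _ /mapP[u + ->]; rewrite mem_enum inE.
Qed.

Lemma tower_set_broadcast : broadcast (@H m n) 3 3 tower_set.
Proof.
apply/forallP=> u.
have : covered (ssval u).
  have /flattenP[c /allpairsP[[y x] [ym xn ->]]] := ssvalP u.
  by apply: octagon_covered; [move: xn | move: ym]; rewrite mem_iota.
case=> [uS|[p [q [/andP[pp sp] /andP[pq sq] Sp Sq pDq]]]].
  by apply: self_tower; rewrite inE.
have [p' pp' Ep] := lift_path _ _ pp; have [q' pq' Eq] := lift_path _ _ pq.
rewrite -Ep -Eq in sp sq Sp Sq pDq; rewrite !size_map in sp sq.
rewrite !last_map in Sp Sq pDq.
by apply: (two_towers _ 3 1 2 _ _ _ _ pp' sp _ pq' sq); rewrite ?inE.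
Qed.

End Octagons.

Theorem corollary5p2 (m n : nat) (hm : 1 <= m) (hn : 1 <= n) :
  gamma (@H m n) 3 3 <= m * n + m + n.
Proof.
have [_ gamma_min] := gammaP (@H m n) (leqnn 3).
exact: leq_trans (gamma_min _ (tower_set_broadcast m n)) (card_tower_set m n).
Qed.
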